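(* Let $m\ge 0$ be an integer and let $\mathbf{r}=(r_0,r_1,\ldots,r_m)$ be a tuple of nonnegative integers with $r_0>0$, and put $r=r_0+r_1+\cdots+r_m$. If $r>1$, then there exists $n_{\mathbf r}$ (depending on $\mathbf r$) such that the sequence $$\frac{\left(S^{(\mathbf r)}(n+1)\right)^{1/(n+1)}}{\left(S^{(\mathbf r)}(n)\right)^{1/n}}$$ is strictly decreasing for $n\ge n_{\mathbf r}$.
   Context: For $\mathbf{r}=(r_0,r_1,\ldots,r_m)$ a tuple of nonnegative integers and $n\ge 0$, $$S^{(\mathbf r)}(n)=\sum_{k=0}^n\binom{n}{k}^{r_0}\binom{n+k}{k}^{r_1}\cdots\binom{n+km}{k}^{r_m},$$ that is, the $k$-th summand is $\prod_{j=0}^m\binom{n+jk}{k}^{r_j}$. *)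

(* Defs.v *)
From mathcomp Require Import all_boot all_order all_algebra.
From mathcomp Require Import reals exp.

Set Implicit Arguments.
Unset Strict Implicit.
Unset Printing Implicit Defensive.

Import Order.TTheory GRing.Theory Num.Theory.

Definition franel_apery (m : nat) (r : m.+1.-tuple nat) (n : nat) : nat :=
  \sum_(0 <= k < n.+1) \prod_(j < m.+1) 'C(n + j * k, k) ^ tnth r j.

Local Open Scope ring_scope.

(* At n = 0 the exponent is 0^-1 = 0, so the value is 1: a convention that is
   irrelevant to properties holding for all large n. *)
Definition nth_root_seq (R : realType) (u : nat -> nat) (n : nat) : R :=
  (u n)%:R `^ (n%:R)^-1.

Definition root_ratio (R : realType) (u : nat -> nat) (n : nat) : R :=
  nth_root_seq R u n.+1 / nth_root_seq R u n.

(* Main.v *)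
Require Import Defs.
From mathcomp Require Import all_boot all_order all_algebra.
From mathcomp Require Import reals sequences exp.
From mathcomp Require Import ring lra.

Import Order.TTheory GRing.Theory Num.Theory.
Local Open Scope ring_scope.

Set Implicit Arguments.
Unset Strict Implicit.
Unset Printing Implicit Defensive.

(** Write S n for the sum and L = ln S.  The ratio of consecutive roots
    decreases exactly when the second difference of L n / n is negative.

    Reduction.  Let Z n = S n * nu ^ n for a constant nu > 0, and z = ln Z.
    Passing from L to z changes L n / n by a constant, so z may replace L.
    The second difference of z n / n at n, multiplied by n (n ^ 2 - 1), is
      n ^ 2 (z (n+1) - 2 z n + z (n-1)) - n (z (n+1) - z (n-1)) + 2 z n.
    If Z (n-1) / Z n = 1 + c / n + O(1 / n ^ 2) for some real c, the first two
    terms are bounded above; if moreover Z n tends to 0, the last one tends to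
    minus infinity and wins ([ln_ratio_diff2]).

    The ratio.  Let t n k be the k-th summand.  Since
    (n + j k) C(n - 1 + j k, k) = (n + j k - k) C(n + j k, k), the quotient
    S (n-1) / S n is exactly the mean of the function
      tau x = prod_j ((1 + (j - 1) x) / (1 + j x)) ^ r_j
    at x = k / n under the probability weights t n k / S n ([mean_drop]).  Such
    means are expanded in powers of 1 / n by Stein's method.  Clearing
    denominators in the hypergeometric ratio t n (k+1) / t n k gives
      t n k * num n k = t n (k+1) * den n (k+1)
    with num and den polynomial in k / n and 1 / n, so by telescoping the mean
    of f ((k+1)/n) num n k - f (k/n) den n k vanishes for every f.  To leading
    order this is the mean of f (P - Q), where P and Q are the limits of num
    and den.  The polynomial P - Q has on [0, 1] a single zero x0, which is
    simple, and it changes sign there from plus to minus.  Taking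
    f = x0 - x and f = (x0 - x) ^ 3 bounds the second and fourth moments of
    x - x0; since P - Q is invertible up to the factor x - x0, any other
    polynomial, and then tau, is f (P - Q) plus a constant modulo
    (x - x0) ^ 4 ([mean_poly_expansion], [mean_rat_expansion]).

    The limit.  With nu = tau x0 and p_j = x0 / (1 + j x0), the saddle
    equation P x0 = Q x0 makes t n k * nu ^ n the product of the binomial
    probabilities of k successes in n + j k trials of parameter p_j, each to
    the power r_j ([normalised_sum]).  The factor j = 0 sums to 1 over k, and
    as sum r_j > 1 there is one more factor, which is O(1 / sqrt n) uniformly
    in k ([pmf_bound]).  Hence Z n tends to 0 ([normalised_small]). *)

(* Evaluation rules that, unlike [hornerE], keep the products and powers in the
   shape they have in the polynomial. *)
Local Notation hornE := (hornerD, hornerN, hornerM, hornerZ, hornerX, hornerC,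
  horner_exp).

(** * Families indexed by n and k, with k at most n, up to powers of 1 / n *)
Section Asymptotics.
Variable R : realFieldType.
Implicit Types (F G : nat -> nat -> R) (p q f h : {poly R}).

Definition isO (d : nat) F : Prop :=
  exists C : R, forall N k, (0 < N)%N -> (k <= N)%N ->
    `|F N k| <= C * (N%:R ^- d).

Arguments isO d%_N F.

Definition scaled (N k : nat) : R := k%:R / N%:R.

Lemma scaled_itv N k : (k <= N)%N -> 0 <= scaled N k <= 1.
Proof.
move=> kN; rewrite /scaled divr_ge0 ?ler0n //=.
case: N kN => [|N] kN; first by rewrite invr0 mulr0 ler01.
by rewrite ler_pdivrMr ?ltr0n // mul1r ler_nat.
Qed.

Lemma isO_le d F G (c : R) :
  (forall N k, (0 < N)%N -> (k <= N)%N -> `|F N k| <= c * `|G N k|) ->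
  isO d G -> isO d F.
Proof.
move=> FG [C GC]; exists (`|c| * C) => N k N0 kN.
apply: le_trans (FG N k N0 kN) _; rewrite -mulrA.
apply: le_trans (ler_wpM2r (normr_ge0 _) (ler_norm c)) _.
by apply: ler_wpM2l => //; exact: GC.
Qed.

Lemma isO_eq d F G :
  (forall N k, (0 < N)%N -> (k <= N)%N -> F N k = G N k) -> isO d G -> isO d F.
Proof. by move=> FG; apply: (@isO_le _ _ _ 1) => N k *; rewrite mul1r FG. Qed.

Lemma isO0 d : isO d (fun _ _ => 0).
Proof. by exists 0 => N k _ _; rewrite normr0 mul0r. Qed.

Lemma isO_add d F G : isO d F -> isO d G -> isO d (fun N k => F N k + G N k).
Proof.
move=> [C FC] [D GD]; exists (C + D) => N k N0 kN; rewrite mulrDl.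
by apply: le_trans (ler_normD _ _) _; apply: lerD; [exact: FC|exact: GD].
Qed.

Lemma isO_mul d e F G :
  isO d F -> isO e G -> isO (d + e) (fun N k => F N k * G N k).
Proof.
move=> [C FC] [D GD]; exists (C * D) => N k N0 kN.
rewrite normrM exprD invfM mulrACA.
by apply: ler_pM => //; [exact: FC|exact: GD].
Qed.

Lemma isO_weaken d e F : (d <= e)%N -> isO e F -> isO d F.
Proof.
move=> de [C FC]; exists `|C| => N k N0 kN; apply: le_trans (FC N k N0 kN) _.
have N1 : 1 <= N%:R :> R by rewrite ler1n.
apply: le_trans (ler_wpM2r _ (ler_norm C)) _; first by rewrite invr_ge0 exprn_ge0.
apply: ler_wpM2l => //; rewrite lef_pV2 ?posrE ?exprn_gt0 ?ltr0n //.
exact: ler_weXn2l.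
Qed.

Lemma isO_opp d F : isO d F -> isO d (fun N k => - F N k).
Proof. by apply: (@isO_le _ _ _ 1) => N k _ _; rewrite mul1r normrN. Qed.

Lemma isO_sub d F G : isO d F -> isO d G -> isO d (fun N k => F N k - G N k).
Proof. by move=> OF OG; apply: isO_add => //; apply: isO_opp. Qed.

Lemma isO_inv : isO 1 (fun N _ => N%:R^-1).
Proof.
by exists 1 => N k N0 _; rewrite mul1r expr1 ger0_norm // invr_ge0 ler0n.
Qed.

Lemma isO_poly p : isO 0 (fun N k => p.[scaled N k]).
Proof.
have [C pC] := poly_itv_bound p 0 1; exists C => N k _ kN.
by rewrite expr0 invr1 mulr1; apply: pC; apply: scaled_itv.
Qed.

(** A first-order expansion, uniform for k / N in [0, 1], with polynomial
    coefficients.  The limit [p] of the ratio of weights governs the drift of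
    the Stein identity below, and [q] enters its correction of order 1 / N. *)
Definition expands F p q : Prop :=
  isO 2 (fun N k => F N k - p.[scaled N k] - q.[scaled N k] / N%:R).

Lemma expands_isO F p q :
  expands F p q -> isO 1 (fun N k => F N k - p.[scaled N k]).
Proof.
move=> E; apply: (@isO_eq _ _ (fun N k =>
  (F N k - p.[scaled N k] - q.[scaled N k] / N%:R) + q.[scaled N k] / N%:R)).
  by move=> N k _ _; rewrite subrK.
apply: isO_add; first exact: isO_weaken E.
by rewrite -[1%N]add0n; apply: isO_mul (isO_poly q) isO_inv.
Qed.

Lemma expands_bounded F p q : expands F p q -> isO 0 F.
Proof.
move=> /expands_isO E; apply: (@isO_eq _ _ (fun N k =>
  (F N k - p.[scaled N k]) + p.[scaled N k])).
  by move=> N k _ _; rewrite subrK.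
apply: isO_add (isO_poly p); exact: isO_weaken E.
Qed.

Lemma expands_eq F G p q p' q' :
  (forall N k, (0 < N)%N -> (k <= N)%N -> F N k = G N k) -> p = p' -> q = q' ->
  expands G p q -> expands F p' q'.
Proof.
by move=> FG <- <-; apply: isO_eq => N k N0 kN; rewrite FG.
Qed.

Lemma expands_affine (a b c : R) :
  expands (fun N k => a + b * scaled N k + c / N%:R) (a%:P + b *: 'X) c%:P.
Proof.
by apply: isO_eq (isO0 2) => N k _ _; rewrite !hornE; ring.
Qed.

Lemma expands_poly p : expands (fun N k => p.[scaled N k]) p 0.
Proof.
by apply: isO_eq (isO0 2) => N k _ _; rewrite horner0; ring.
Qed.

Lemma expands_sub F G p q p' q' : expands F p q -> expands G p' q' ->
  expands (fun N k => F N k - G N k) (p - p') (q - q').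
Proof.
move=> EF EG; apply: isO_eq (isO_sub EF EG) => N k _ _.
by rewrite !hornE; ring.
Qed.

Lemma expands_mul F G p q p' q' : expands F p q -> expands G p' q' ->
  expands (fun N k => F N k * G N k) (p * p') (q * p' + p * q').
Proof.
move=> EF EG; have bF := expands_bounded EF.
pose x := scaled.
apply: (@isO_eq _ _ (fun N k =>
   F N k * (G N k - p'.[x N k] - q'.[x N k] / N%:R)
   + (F N k - p.[x N k] - q.[x N k] / N%:R) * p'.[x N k]
   + (F N k - p.[x N k]) * (q'.[x N k] / N%:R))).
  by move=> N k N0 kN; rewrite !hornE /x; ring.
apply: isO_add; first apply: isO_add.
- exact: (isO_mul bF EG).
- by rewrite -(addn0 2%N); apply: isO_mul EF (isO_poly p').
- apply: (isO_mul (expands_isO EF)).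
  exact: (isO_mul (isO_poly q') isO_inv).
Qed.

Lemma expands_exp F p q n : expands F p q ->
  exists q', expands (fun N k => F N k ^+ n) (p ^+ n) q'.
Proof.
move=> EF; elim: n => [|n [q' IH]].
  exists 0; apply: expands_eq (expands_poly 1) => // N k _ _.
  by rewrite hornerC.
eexists; apply: expands_eq (expands_mul EF IH) => //.
- by move=> N k _ _; rewrite exprS.
- by rewrite exprS.
Qed.

Lemma expands_prod (I : Type) (s : seq I) (F : I -> nat -> nat -> R)
    (p : I -> {poly R}) :
  (forall i, exists q, expands (F i) (p i) q) ->
  exists q, expands (fun N k => \prod_(i <- s) F i N k) (\prod_(i <- s) p i) q.
Proof.
move=> EF; elim: s => [|i s [q IH]].
  exists 0; apply: expands_eq (expands_poly 1) => [N k _ _| |//];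
  by rewrite !big_nil ?hornerC.
have [q' Ei] := EF i.
eexists; apply: expands_eq (expands_mul Ei IH) => //.
- by move=> N k _ _; rewrite big_cons.
- by rewrite big_cons.
Qed.

(** Taylor's formula: moving k by one moves k / N by 1 / N. *)
Lemma expands_shift f : expands (fun N k => f.[scaled N k.+1]) f f^`().
Proof.
elim/poly_ind: f => [|f c IH].
  by apply: expands_eq (expands_poly 0) => // *; rewrite ?horner0 ?deriv0.
have EX : expands (fun N k => scaled N k.+1) 'X 1.
  apply: expands_eq (expands_affine 0 1 1) => [N k _ _| |//].
    by rewrite /scaled -natr1; ring.
  by rewrite scale1r add0r.
have E := expands_mul IH EX.
have Ec : expands (fun _ _ => - c) (- c%:P) 0.
  by apply: expands_eq (expands_poly (- c%:P)) => // *; rewrite !hornE.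
apply: expands_eq (expands_sub E Ec).
- by move=> N k _ _; rewrite hornerMXaddC opprK.
- by rewrite opprK.
- by rewrite derivD derivM derivX derivC subr0 addr0.
Qed.

End Asymptotics.

Arguments scaled {R}.

(** * Stein's method for a hypergeometric family of weights *)
Section Mean.
Variables (R : realFieldType) (t : nat -> nat -> R).
Implicit Types (F G : nat -> nat -> R) (p q f h : {poly R}).
Hypothesis t_ge0 : forall N k, 0 <= t N k.
Arguments isO {R} d%_N F.

Definition mass (N : nat) : R := \sum_(k < N.+1) t N k.
Hypothesis mass_gt0 : forall N, 0 < mass N.

Definition mean (N : nat) (g : nat -> R) : R :=
  (\sum_(k < N.+1) t N k * g k) / mass N.

Lemma meanD N g g' : mean N (fun k => g k + g' k) = mean N g + mean N g'.
Proof.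
rewrite /mean -mulrDl -big_split /=; congr (_ / _).
by apply: eq_bigr => k _; rewrite mulrDr.
Qed.

Lemma meanZ N c g : mean N (fun k => c * g k) = c * mean N g.
Proof.
rewrite /mean mulrA mulr_sumr; congr (_ / _).
by apply: eq_bigr => k _; rewrite mulrCA.
Qed.

Lemma mean_eq N g g' :
  (forall k, (k <= N)%N -> g k = g' k) -> mean N g = mean N g'.
Proof.
by move=> E; congr (_ / _); apply: eq_bigr => k _; rewrite E // -ltnS.
Qed.

Lemma mean_cst N c : mean N (fun _ => c) = c.
Proof.
by rewrite /mean -mulr_suml mulrC mulrA mulVf ?mul1r // gt_eqF.
Qed.

Lemma mean_le N g g' :
  (forall k, (k <= N)%N -> g k <= g' k) -> mean N g <= mean N g'.
Proof.
move=> le_gg'; rewrite ler_pM2r ?invr_gt0 //.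
by apply: ler_sum => k _; apply: ler_wpM2l => //; apply: le_gg'; rewrite -ltnS.
Qed.

Lemma mean_norm N g : `|mean N g| <= mean N (fun k => `|g k|).
Proof.
rewrite /mean normrM normfV (gtr0_norm (mass_gt0 N)).
rewrite ler_pM2r ?invr_gt0 //; apply: le_trans (ler_norm_sum _ _ _) _.
by apply: ler_sum => k _; rewrite normrM (ger0_norm (t_ge0 _ _)).
Qed.

Lemma isO_mean d F : isO d F -> isO d (fun N _ => mean N (F N)).
Proof.
move=> [C FC]; exists C => N k N0 _; apply: le_trans (mean_norm _ _) _.
by rewrite -[leRHS](mean_cst N); apply: mean_le => k'; apply: FC.
Qed.

Variables (num den : nat -> nat -> R) (P P1 Q Q1 : {poly R}) (x0 w : R).
(** The sum telescopes when t N k * num N k = t N k.+1 * den N k.+1 and the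
    boundary terms den N 0 and t N N.+1 vanish. *)
Hypothesis summation_by_parts : forall N (g : nat -> R), (0 < N)%N ->
  \sum_(k < N.+1) t N k * (g k.+1 * num N k - g k * den N k) = 0.
Hypothesis num_expands : expands num P P1.
Hypothesis den_expands : expands den Q Q1.
Hypothesis w_gt0 : 0 < w.
Hypothesis x0_itv : 0 < x0 < 1.
Hypothesis drift : forall x, 0 <= x <= 1 ->
  w * (x - x0) ^+ 2 <= (x0 - x) * (P - Q).[x].

(** The coefficient of 1 / N in the expansion of
    f ((k+1)/N) num N k - f (k/N) den N k. *)
Definition defect f : {poly R} := f^`() * P + f * (P1 - Q1).

Lemma mean_stein f :
  isO 2 (fun N _ => mean N (fun k => (f * (P - Q)).[scaled N k])
                      + mean N (fun k => (defect f).[scaled N k]) / N%:R).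
Proof.
have E1 := expands_mul (expands_shift f) num_expands.
have E2 := expands_mul (expands_poly f) den_expands.
apply: isO_eq (isO_opp (isO_mean (expands_sub E1 E2))).
move=> N _ N0 _ /=.
have st := summation_by_parts (fun k => f.[scaled N k]) N0.
pose g k := f.[scaled N k.+1] * num N k - f.[scaled N k] * den N k.
have g0 : mean N g = 0 by rewrite /mean st mul0r.
rewrite -[LHS]subr0 -g0 -[X in _ - X]mul1r -mulNr -[LHS]opprK; congr (- _).
rewrite ![_ / N%:R]mulrC -[LHS]mulN1r -!meanZ -!meanD -!meanZ.
by apply: mean_eq => k kN /=; rewrite /g /defect !hornE; ring.
Qed.

Lemma mean_stein_isO1 f :
  isO 1 (fun N _ => mean N (fun k => (f * (P - Q)).[scaled N k])).
Proof.
have O2 := isO_weaken (isT : (1 <= 2)%N) (mean_stein f).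
have Od := isO_mean (isO_poly (defect f)).
apply: isO_eq (isO_sub O2 (isO_mul Od (isO_inv R))).
by move=> N k _ _; rewrite addrK.
Qed.

(** Variance bound: for f = x0 - x the leading term f (P - Q) of the Stein
    identity is at least w (x - x0) ^ 2, and its mean is O(1 / N). *)
Lemma isO_mean_pow2M s :
  isO 1 (fun N _ => mean N (fun k => (('X - x0%:P) ^+ 2 * s).[scaled N k])).
Proof.
have [C sC] := isO_poly s.
have Of := mean_stein_isO1 (x0%:P - 'X).
apply: (@isO_le _ _ _ _ (`|C| / w) _ Of) => N k N0 kN.
rewrite [leRHS]mulrAC ler_pdivlMr //.
apply: le_trans (ler_wpM2l (normr_ge0 _) (ler_norm _)).
apply: le_trans (ler_wpM2r (ltW w_gt0) (mean_norm _ _)) _.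
rewrite mulrC -!meanZ; apply: mean_le => j jN.
have := drift (scaled_itv R jN); rewrite !hornE => dr.
have := sC N j N0 jN; rewrite expr0 invr1 mulr1 => sj.
rewrite normrM (ger0_norm (sqr_ge0 _)) [leLHS]mulrA [leLHS]mulrC.
apply: ler_pM => //; first by rewrite mulr_ge0 ?sqr_ge0 ?ltW.
exact: le_trans sj (ler_norm _).
Qed.

(** For f = (x0 - x) ^ 3 the correction [defect f] is itself divisible by
    (x - x0) ^ 2, so the variance bound gains a second factor 1 / N. *)
Lemma isO_mean_pow4M s :
  isO 2 (fun N _ => mean N (fun k => (('X - x0%:P) ^+ 4 * s).[scaled N k])).
Proof.
have [C sC] := isO_poly s.
pose f := (x0%:P - 'X : {poly R}) ^+ 3.
have fd : defect f = ('X - x0%:P) ^+ 2 * (- 3%:R * P + (x0%:P - 'X) * (P1 - Q1)).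
  rewrite /defect /f deriv_exp derivB derivC derivX sub0r -mulr_natl /=; ring.
have Of : isO 2 (fun N _ => mean N (fun k => (f * (P - Q)).[scaled N k])).
  have := mean_stein f; rewrite fd => O2.
  have Od := isO_mul (isO_mean_pow2M (- 3%:R * P + (x0%:P - 'X) * (P1 - Q1)))
    (isO_inv R).
  by apply: isO_eq (isO_sub O2 Od) => N k _ _; rewrite addrK.
apply: (@isO_le _ _ _ _ (`|C| / w) _ Of) => N k N0 kN.
rewrite [leRHS]mulrAC ler_pdivlMr //.
apply: le_trans (ler_wpM2l (normr_ge0 _) (ler_norm _)).
apply: le_trans (ler_wpM2r (ltW w_gt0) (mean_norm _ _)) _.
rewrite mulrC -!meanZ; apply: mean_le => j jN.
have := drift (scaled_itv R jN); rewrite !hornE => dr.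
have := sC N j N0 jN; rewrite expr0 invr1 mulr1 => sj.
set x := scaled N j in dr sj *.
have p4 : 0 <= (x - x0) ^+ 4 by rewrite (exprM _ 2 2) sqr_ge0.
rewrite normrM ger0_norm // [leLHS]mulrA [leLHS]mulrC.
apply: ler_pM => //; first by rewrite mulr_ge0 // ltW.
  exact: le_trans sj (ler_norm _).
have := ler_wpM2l (sqr_ge0 (x - x0)) dr.
set u := (P.[x] - Q.[x]); lra.
Qed.

Hypothesis root0 : (P - Q).[x0] = 0.

(** Near x0 a multiple zero of P - Q would be too flat for the quadratic lower
    bound [drift]. *)
Lemma drift_factor : exists2 W, P - Q = W * ('X - x0%:P) & W.[x0] != 0.
Proof.
have /factor_theorem[W PQ] : root (P - Q) x0 by apply/eqP.
exists W => //; apply/eqP => /eqP /factor_theorem[Y WY].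
have [C YC] := poly_itv_bound Y 0 1.
have /andP[x0_gt0 x0_lt1] := x0_itv.
have C0 : 0 <= C by apply: le_trans (YC 0 _); rewrite ?lexx ?ler01.
have C1 : 0 < C + 1 by lra.
(* At distance d the cubic upper bound falls below the quadratic lower one. *)
pose d := Num.min (1 - x0) (w / (C + 1)).
have d0 : 0 < d by rewrite lt_min subr_gt0 x0_lt1 divr_gt0.
have d1 : d <= 1 - x0 by rewrite ge_min lexx.
have dC : d * (C + 1) <= w by rewrite -ler_pdivlMr // ge_min lexx orbT.
have yI : 0 <= x0 + d <= 1 by apply/andP; split; lra.
have /ler_normlP[YCd _] := YC _ yI.
have := drift yI; rewrite PQ WY !hornE.
move: (Y.[_]) YCd => y yC; move: d d0 dC {d1 yI} => d d0 dC dr.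
have d2 : 0 < d ^+ 2 by apply: exprn_gt0.
have : w * d ^+ 2 <= (- y * d) * d ^+ 2 by lra.
rewrite ler_pM2r // => le_w.
have := ler_wpM2r (ltW d0) yC; lra.
Qed.

(** The cofactor of x - x0 in P - Q is invertible modulo any power of x - x0,
    so division by P - Q is possible up to such a power, within polynomials. *)
Lemma drift_split h n :
  exists f s, h = h.[x0]%:P + f * (P - Q) + ('X - x0%:P) ^+ n.+1 * s.
Proof.
have [W PQ W0] := drift_factor.
have /factor_theorem[V hV] : root (h - h.[x0]%:P) x0.
  by rewrite /root !hornE subrr.
have : coprimep W (('X - x0%:P) ^+ n).
  by apply: coprimep_expr; rewrite coprimep_XsubC.
case/Bezout_eq1_coprimepP => -[a b] /= ab.
exists (V * a), (V * b); rewrite PQ exprS.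
transitivity (h.[x0]%:P + V * (a * W + b * ('X - x0%:P) ^+ n) * ('X - x0%:P)).
  by rewrite ab mulr1 -hV addrC subrK.
ring.
Qed.

Lemma mean_poly_isO1 h :
  isO 1 (fun N _ => mean N (fun k => h.[scaled N k]) - h.[x0]).
Proof.
have [f [s E]] := drift_split h 1.
apply: isO_eq (isO_add (mean_stein_isO1 f) (isO_mean_pow2M s)) => N _ N0 _.
rewrite -[h.[x0]](mean_cst N) -[X in _ - X]mul1r -mulNr -meanZ -!meanD.
by apply: mean_eq => k _; rewrite {1}E !hornE; ring.
Qed.

(** The Stein identity turns the part f (P - Q) of [h] into - 1 / N times
    the mean of [defect f], which is its value at x0 up to O(1 / N). *)
Theorem mean_poly_expansion h : exists e : R,
  isO 2 (fun N _ => mean N (fun k => h.[scaled N k]) - h.[x0] - e / N%:R).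
Proof.
have [f [s E]] := drift_split h 3.
exists (- (defect f).[x0]).
have O1 := isO_mul (mean_poly_isO1 (defect f)) (isO_inv R).
apply: isO_eq (isO_sub (isO_add (mean_stein f) (isO_mean_pow4M s)) O1).
move=> N _ N0 _.
have -> : mean N (fun k => h.[scaled N k]) =
  h.[x0] + mean N (fun k => (f * (P - Q)).[scaled N k])
  + mean N (fun k => (('X - x0%:P) ^+ 4 * s).[scaled N k]).
  rewrite -[h.[x0]](mean_cst N) -!meanD.
  by apply: mean_eq => k _; rewrite {1}E !hornE; ring.
by ring.
Qed.

(** Inverting [B] modulo (x - x0) ^ 4 reduces to a polynomial; the remainder is
    controlled by the fourth moment because [B] stays away from 0. *)
Theorem mean_rat_expansion (A B : {poly R}) :
  (forall x, 0 <= x <= 1 -> 1 <= B.[x]) -> exists e : R,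
  isO 2 (fun N _ => mean N (fun k => A.[scaled N k] / B.[scaled N k])
    - A.[x0] / B.[x0] - e / N%:R).
Proof.
move=> B1.
have xI : 0 <= x0 <= 1 by case/andP: x0_itv => *; rewrite !ltW.
have Bx0 : B.[x0] != 0 by rewrite gt_eqF // (lt_le_trans ltr01 (B1 x0 xI)).
have : coprimep B (('X - x0%:P) ^+ 4).
  by apply: coprimep_expr; rewrite coprimep_XsubC.
case/Bezout_eq1_coprimepP => -[a b] /= ab.
have abx x : B.[x] != 0 ->
    A.[x] / B.[x] = (A * a).[x] + (x - x0) ^+ 4 * ((A * b).[x] / B.[x]).
  move=> Bx; have := congr1 (fun p => p.[x]) ab; rewrite !hornE => abx.
  rewrite -[A.[x] in LHS]mulr1 -abx; field.
  exact: Bx.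
have [e O2] := mean_poly_expansion (A * a).
exists e.
have [C sC] := isO_poly (A * b).
suff Orem : isO 2 (fun N _ => mean N (fun k =>
     (scaled N k - x0) ^+ 4 * ((A * b).[scaled N k] / B.[scaled N k]))).
  apply: isO_eq (isO_add O2 Orem) => N _ N0 _.
  rewrite (abx x0) // subrr expr0n mul0r addr0.
  have -> : mean N (fun k => A.[scaled N k] / B.[scaled N k]) =
     mean N (fun k => (A * a).[scaled N k]) + mean N (fun k =>
     (scaled N k - x0) ^+ 4 * ((A * b).[scaled N k] / B.[scaled N k])).
    rewrite -meanD; apply: mean_eq => k kN; apply: abx.
    by rewrite gt_eqF // (lt_le_trans ltr01 (B1 _ (scaled_itv R kN))).
  ring.
apply: (@isO_le _ _ _ _ `|C| _ (isO_mean_pow4M 1)) => N k N0 kN.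
apply: le_trans (mean_norm _ _) _.
apply: le_trans (ler_wpM2l (normr_ge0 _) (ler_norm _)).
rewrite -meanZ; apply: mean_le => j jN.
have p4 x : 0 <= (x - x0) ^+ 4 by rewrite (exprM _ 2 2) sqr_ge0.
rewrite mulr1 [in leRHS]horner_exp hornerXsubC normrM ger0_norm // [leLHS]mulrC.
apply: ler_wpM2r => //.
have Bx := B1 _ (scaled_itv R jN).
rewrite normrM normfV (ger0_norm (le_trans ler01 Bx)).
rewrite ler_pdivrMr ?(lt_le_trans ltr01) //.
have := sC N j N0 jN; rewrite expr0 invr1 mulr1 => /le_trans-> //.
apply: le_trans (ler_norm _) _; rewrite -[leLHS]mulr1.
exact: ler_wpM2l.
Qed.
End Mean.

(** * The ratio of consecutive coefficients C(n + j k, k) *)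
Section BinomialSteps.
Variable R : realFieldType.

(** C(N + j (k+1), k+1) / C(N + j k, k) is the quotient of [step_num j N k] by
    [step_den j N k.+1], both divided by N ^ j (by N when j = 0) to become
    polynomials in k / N and 1 / N; [step_num_lim j] and [step_den_lim j] are
    their limits.  The case j = 0 stands apart because there the numerator N - k
    replaces a product of j factors. *)
Definition step_num_lim (j : nat) : {poly R} :=
  if j is 0%N then 1 - 'X else (1 + j%:R *: 'X) ^+ j.
Definition step_den_lim (j : nat) : {poly R} := 'X * (1 + j.-1%:R *: 'X) ^+ j.-1.

Definition step_num (j N k : nat) : R :=
  if j is 0%N then 1 - scaled N k
  else \prod_(i < j) (1 + j%:R * scaled N k + i.+1%:R / N%:R).
Definition step_den (j N k : nat) : R :=
  scaled N k *
  \prod_(i < j.-1) (1 + j.-1%:R * scaled N k + (i.+1%:R - j.-1%:R) / N%:R).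

Lemma fact_addn (M j : nat) :
  ((M + j)`! = (\prod_(i < j) (M + i.+1)) * M`!)%N.
Proof.
elim: j => [|j IH]; first by rewrite addn0 big_ord0 mul1n.
by rewrite addnS factS IH big_ord_recr /= -addnS mulnA; congr muln; rewrite mulnC.
Qed.

Lemma bin_step_prod (j N k : nat) :
  ((\prod_(i < j.+1) (N + j.+1 * k + i.+1)) * 'C(N + j.+1 * k, k) =
   k.+1 * (\prod_(i < j) (N + j * k + i.+1)) * 'C(N + j.+1 * k.+1, k.+1))%N.
Proof.
have e1 : (N + j.+1 * k - k = N + j * k)%N by rewrite mulSn addnCA addKn.
have e2 : (N + j.+1 * k.+1 - k.+1 = N + j * k + j)%N.
  by rewrite mulSn addnCA addKn mulnS [(j + _)%N]addnC addnA.
have l1 : (k <= N + j.+1 * k)%N by rewrite mulSn addnCA leq_addr.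
have l2 : (k.+1 <= N + j.+1 * k.+1)%N by rewrite mulSn addnCA leq_addr.
have b1 := bin_fact l1; have b2 := bin_fact l2.
rewrite e1 in b1; rewrite e2 fact_addn factS in b2.
have M0 : (0 < k`! * (N + j * k)`!)%N by rewrite muln_gt0 !fact_gt0.
apply/eqP; rewrite -(eqn_pmul2r M0) -mulnA b1 -fact_addn; apply/eqP.
have -> : (N + j.+1 * k + j.+1 = N + j.+1 * k.+1)%N by rewrite -addnA -mulnSr.
by rewrite -b2; ring.
Qed.

Lemma bin_step_ratio (j N k : nat) : (0 < N)%N -> (k <= N)%N ->
  'C(N + j * k, k)%:R * step_num j N k =
  'C(N + j * k.+1, k.+1)%:R * step_den j N k.+1.
Proof.
move=> N0 kN; have Nn0 : N%:R != 0 :> R by rewrite pnatr_eq0 -lt0n.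
case: j => [|j]; rewrite /step_num /step_den.
  rewrite !mul0n !addn0 big_ord0 mulr1 /scaled.
  have := congr1 (fun n => n%:R : R) (mul_bin_left N k).
  rewrite !natrM natrB // => E.
  transitivity ((N%:R - k%:R) * 'C(N, k)%:R / N%:R : R); first by field.
  by rewrite -E; ring.
have := congr1 (fun n => n%:R : R) (bin_step_prod j N k).
rewrite !natrM !natr_prod => E.
have -> : \prod_(i < j.+1) (1 + j.+1%:R * scaled N k + i.+1%:R / N%:R) =
  (\prod_(i < j.+1) (N + j.+1 * k + i.+1)%:R) / N%:R ^+ j.+1 :> R.
  rewrite -[X in _ / _ ^+ X](card_ord (j.+1)) -prodr_const.
  under [X in _ / X]eq_bigl do rewrite inE.
  rewrite -[RHS]prodf_div; apply: eq_bigr => i _.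
  by rewrite /scaled !natrD natrM; field.
have -> : \prod_(i < j.+1.-1)
    (1 + j%:R * scaled N k.+1 + (i.+1%:R - j%:R) / N%:R) =
  (\prod_(i < j) (N + j * k + i.+1)%:R) / N%:R ^+ j :> R.
  rewrite -[X in _ / _ ^+ X](card_ord (j)) -prodr_const.
  under [X in _ / X]eq_bigl do rewrite inE.
  rewrite -[RHS]prodf_div; apply: eq_bigr => i _.
  by rewrite /scaled !natrD natrM -[k.+1%:R]natr1; field.
rewrite [LHS]mulrA [X in X / _ = _]mulrC E /scaled exprS.
by field; rewrite ?expf_neq0 ?Nn0.
Qed.

Lemma step_num_expands j : exists q, expands (step_num j) (step_num_lim j) q.
Proof.
rewrite /step_num /step_num_lim; case: j => [|j].
  exists 0; apply: expands_eq (expands_affine 1 (- 1) 0) => // [N k _ _|].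
    by ring.
  by rewrite scaleN1r.
have [q E] := @expands_prod R _ (index_enum 'I_j.+1)
  (fun i N k => 1 + j.+1%:R * scaled N k + i.+1%:R / N%:R)
  (fun i => 1%:P + j.+1%:R *: 'X)
  (fun i => ex_intro _ _ (expands_affine 1 _ _)).
by exists q; apply: expands_eq E => //; rewrite prodr_const card_ord.
Qed.

Lemma step_den_expands j : exists q, expands (step_den j) (step_den_lim j) q.
Proof.
have [q E] := @expands_prod R _ (index_enum 'I_j.-1)
  (fun i N k => 1 + j.-1%:R * scaled N k + (i.+1%:R - j.-1%:R) / N%:R)
  (fun i => 1%:P + j.-1%:R *: 'X)
  (fun i => ex_intro _ _ (expands_affine 1 _ _)).
eexists; apply: expands_eq (expands_mul (expands_poly 'X) E) => //.
  by move=> N k _ _; rewrite /step_den hornerX.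
by rewrite prodr_const card_ord.
Qed.

Lemma step_den_lim_ge0 j x : 0 <= x -> 0 <= (step_den_lim j).[x].
Proof.
move=> x0; rewrite /step_den_lim !hornE mulr_ge0 // exprn_ge0 //.
by rewrite addr_ge0 // mulr_ge0.
Qed.

Lemma step_den_lim_gt0 j x : 0 < x -> 0 < (step_den_lim j).[x].
Proof.
move=> x0; rewrite /step_den_lim !hornE mulr_gt0 // exprn_gt0 //.
by rewrite ltr_wpDr // mulr_ge0 // ltW.
Qed.

Lemma step_den_lim_le j x y : 0 <= x -> x <= y ->
  (step_den_lim j).[x] <= (step_den_lim j).[y].
Proof.
move=> x0 xy; rewrite /step_den_lim !hornE.
have h z : 0 <= z -> 0 <= 1 + j.-1%:R * z.
  by move=> z0; rewrite addr_ge0 // mulr_ge0.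
apply: ler_pM => //; first exact/exprn_ge0/h.
apply: lerXn2r; rewrite ?nnegrE ?h // ?(le_trans x0) //.
by rewrite lerD2l ler_wpM2l.
Qed.

Lemma step_num_limS_ge1 j x : 0 <= x -> 1 <= (step_num_lim j.+1).[x].
Proof.
move=> x0; rewrite /step_num_lim !hornE exprn_ege1 //.
by rewrite lerDl mulr_ge0.
Qed.

Lemma step_num_lim_ge0 j x : 0 <= x <= 1 -> 0 <= (step_num_lim j).[x].
Proof.
case/andP=> x0 x1; case: j => [|j]; last exact: le_trans (step_num_limS_ge1 _ x0).
by rewrite /step_num_lim !hornE subr_ge0.
Qed.

(** Bernoulli's inequality for (1 - d / U) ^ n, without division. *)
Lemma bernoulli_sub (U d : R) n : 0 <= d -> d <= U ->
  U ^+ n * (U - n%:R * d) <= (U - d) ^+ n * U.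
Proof.
move=> d0 dU; elim: n => [|n IH]; first by rewrite !expr0; lra.
have Un : 0 <= U ^+ n by rewrite exprn_ge0 // (le_trans d0).
rewrite !exprS -natr1.
have := ler_wpM2l (_ : 0 <= U - d) IH; rewrite subr_ge0 => /(_ dU).
have : 0 <= U ^+ n * (n%:R * d ^+ 2) by rewrite !mulr_ge0 ?sqr_ge0.
lra.
Qed.

(** The limiting ratio [step_num_lim j] / [step_den_lim j] is nonincreasing.
    For j = i + 1, with U = (1 + j y)(1 + i x), the claim compares the i-th
    powers of U and of U - (y - x), so Bernoulli's inequality reduces it to
    degree one in U. *)
Lemma step_lim_cross_le j x y : 0 <= x -> x <= y -> y <= 1 ->
  (step_num_lim j).[y] * (step_den_lim j).[x] <=
  (step_num_lim j).[x] * (step_den_lim j).[y].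
Proof.
move=> x0 xy y1; rewrite /step_num_lim /step_den_lim.
case: j => [|i]; first by rewrite !hornE; lra.
rewrite !hornE /= !exprS -natr1.
set I := i%:R : R; have I0 : 0 <= I by rewrite /I.
pose U := (1 + (I + 1) * y) * (1 + I * x).
pose V := (1 + (I + 1) * x) * (1 + I * y).
have VE : V = U - (y - x) by rewrite /V /U; ring.
have y0 : 0 <= y by lra.
have a1 : 0 <= I * x by rewrite mulr_ge0.
have a2 : 0 <= I * y by rewrite mulr_ge0.
have a3 : 0 <= I * (x * y) by rewrite !mulr_ge0.
have a4 : 0 <= I * I * (x * y) by rewrite !mulr_ge0.
have dU : y - x <= U by rewrite /U; nra.
have U0 : 0 < U by rewrite /U; nra.
suff : x * (1 + (I + 1) * y) * U ^+ i <= y * (1 + (I + 1) * x) * V ^+ i.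
  rewrite /U /V !exprMn; congr (_ <= _); ring.
rewrite -(ler_pM2r U0) VE -[leRHS]mulrA.
have p0 : 0 <= y * (1 + (I + 1) * x) by rewrite mulr_ge0 //; lra.
have d0 : 0 <= y - x by lra.
apply: le_trans (ler_wpM2l p0 (bernoulli_sub i d0 dU)).
rewrite -[leLHS]mulrA mulrCA [leRHS]mulrCA ler_wpM2l ?exprn_ge0 ?(ltW U0) //.
rewrite -/I -subr_ge0.
have -> : y * (1 + (I + 1) * x) * (U - I * (y - x)) - x * (1 + (I + 1) * y) * U =
  (y - x) * (1 + y + I * x) by rewrite /U; ring.
by rewrite mulr_ge0 //; lra.
Qed.

End BinomialSteps.
Arguments step_num_lim : simpl never.
Arguments step_num : simpl never.

(** * The summands and their Stein identity *)
Section FranelApery.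
Variables (R : realType) (m : nat) (r : m.+1.-tuple nat).
Hypothesis r0_gt0 : (0 < tnth r ord0)%N.

Definition summand (N k : nat) : R :=
  \prod_(j < m.+1) 'C(N + j * k, k)%:R ^+ tnth r j.

Lemma franel_aperyE N :
  (franel_apery r N)%:R = \sum_(k < N.+1) summand N k :> R.
Proof.
rewrite /franel_apery natr_sum big_mkord; apply: eq_bigr => k _.
by rewrite natr_prod; apply: eq_bigr => j _; rewrite natrX.
Qed.

Lemma summand_ge0 N k : 0 <= summand N k.
Proof. by apply: prodr_ge0 => j _; rewrite exprn_ge0. Qed.

Lemma franel_apery_gt0 N : 0 < (franel_apery r N)%:R :> R.
Proof.
rewrite franel_aperyE (bigD1 ord0) //= ltr_pwDl ?sumr_ge0 //.
  by rewrite /summand big1 // => j _; rewrite bin0 expr1n.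
by move=> k _; apply: summand_ge0.
Qed.

Lemma summand_gtn N k : (N < k)%N -> summand N k = 0.
Proof.
move=> Nk; rewrite /summand big_ord_recl mul0n addn0 bin_small //.
by rewrite expr0n gtn_eqF // mul0r.
Qed.

Definition term_num (N k : nat) : R :=
  \prod_(j < m.+1) step_num R j N k ^+ tnth r j.
Definition term_den (N k : nat) : R :=
  \prod_(j < m.+1) step_den R j N k ^+ tnth r j.
Definition term_num_lim : {poly R} :=
  \prod_(j < m.+1) step_num_lim R j ^+ tnth r j.
Definition term_den_lim : {poly R} :=
  \prod_(j < m.+1) step_den_lim R j ^+ tnth r j.

Lemma term_num_expands : exists q, expands term_num term_num_lim q.
Proof.
apply: expands_prod => j; have [q E] := step_num_expands R j.
exact: expands_exp E.
Qed.

Lemma term_den_expands : exists q, expands term_den term_den_lim q.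
Proof.
apply: expands_prod => j; have [q E] := step_den_expands R j.
exact: expands_exp E.
Qed.

Lemma summand_step N k : (0 < N)%N -> (k <= N)%N ->
  summand N k * term_num N k = summand N k.+1 * term_den N k.+1.
Proof.
move=> N0 kN; rewrite /summand /term_num /term_den -!big_split /=.
by apply: eq_bigr => j _; rewrite -!exprMn bin_step_ratio.
Qed.

Lemma term_den0 N : term_den N 0 = 0.
Proof.
rewrite /term_den big_ord_recl /step_den /scaled !mul0r expr0n gtn_eqF //.
by rewrite mul0r.
Qed.

Lemma summand_stein N (g : nat -> R) : (0 < N)%N ->
  \sum_(k < N.+1) summand N k * (g k.+1 * term_num N k - g k * term_den N k) = 0.
Proof.
move=> N0; pose G k := g k * (summand N k * term_den N k).
transitivity (\sum_(0 <= k < N.+1) (G k.+1 - G k)); last first.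
  rewrite telescope_sumr // /G term_den0 (summand_gtn (ltnSn N)).
  by rewrite mul0r !mulr0 subrr.
rewrite big_mkord; apply: eq_bigr => k _.
rewrite /G -summand_step //; first by ring.
by rewrite -ltnS.
Qed.

(** Every factor of the limiting ratio is nonincreasing, and the factor j = 0,
    which is (1 - x) / x, is so at a definite rate; hence the whole ratio is
    strictly decreasing, with one bound for all intervals that contain x0. *)
Lemma term_lim_cross x0 : 0 < x0 < 1 -> exists2 w : R, 0 < w &
  forall x y, 0 <= x -> x <= x0 -> x0 <= y -> y <= 1 ->
  (y - x) * w <=
    term_num_lim.[x] * term_den_lim.[y] - term_num_lim.[y] * term_den_lim.[x].
Proof.
case/andP=> x0_gt0 x0_lt1.
pose D z : R :=
  \prod_(j < m) (step_den_lim R (lift ord0 j)).[z] ^+ tnth r (lift ord0 j).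
exists (((1 - x0) * x0) ^+ (tnth r ord0).-1 * D x0).
  rewrite mulr_gt0 ?exprn_gt0 ?mulr_gt0 ?subr_gt0 //.
  by apply: prodr_gt0 => j _; rewrite exprn_gt0 ?step_den_lim_gt0.
move=> x y x_ge0 xx0 x0y y_le1.
have xy : x <= y by lra.
have xI : 0 <= x <= 1 by apply/andP; split; lra.
have yI : 0 <= y <= 1 by apply/andP; split; lra.
have y_ge0 : 0 <= y by lra.
pose U : R := \prod_(j < m) ((step_num_lim R (lift ord0 j)).[x]
   * (step_den_lim R (lift ord0 j)).[y]) ^+ tnth r (lift ord0 j).
pose V : R := \prod_(j < m) ((step_num_lim R (lift ord0 j)).[y]
   * (step_den_lim R (lift ord0 j)).[x]) ^+ tnth r (lift ord0 j).
have crossE a b : term_num_lim.[a] * term_den_lim.[b] =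
   ((1 - a) * b) ^+ tnth r ord0 *
   \prod_(j < m) ((step_num_lim R (lift ord0 j)).[a]
   * (step_den_lim R (lift ord0 j)).[b]) ^+ tnth r (lift ord0 j).
  rewrite /term_num_lim /term_den_lim !horner_prod -big_split big_ord_recl /=.
  congr (_ * _).
    by rewrite !horner_exp -exprMn /= !hornE mulr1.
  by apply: eq_bigr => j _; rewrite !horner_exp -exprMn.
rewrite !crossE -/U -/V.
have VU : V <= U.
  apply: ler_prod => j _; 
    rewrite exprn_ge0 ?mulr_ge0 ?step_num_lim_ge0 ?step_den_lim_ge0 //=.
  apply: lerXn2r;
    rewrite ?nnegrE ?mulr_ge0 ?step_num_lim_ge0 ?step_den_lim_ge0 //.
  exact: step_lim_cross_le.
have DU : D x0 <= U.
  apply: ler_prod => j _; rewrite exprn_ge0 ?step_den_lim_ge0 ?(ltW x0_gt0) //=.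
  apply: lerXn2r;
    rewrite ?nnegrE ?mulr_ge0 ?step_num_lim_ge0 ?step_den_lim_ge0
      ?(ltW x0_gt0) //.
  apply: le_trans (step_den_lim_le _ (ltW x0_gt0) x0y) _.
  by rewrite -[leLHS]mul1r ler_wpM2r ?step_den_lim_ge0 ?step_num_limS_ge1.
have D0 : 0 <= D x0.
  by apply: prodr_ge0 => j _; rewrite exprn_ge0 ?step_den_lim_ge0 ?(ltW x0_gt0).
have U0 := le_trans D0 DU.
have /prednK <- := r0_gt0; set n := (tnth r ord0).-1.
pose u := (1 - x) * y; pose v := (1 - y) * x.
have v0 : 0 <= v by rewrite mulr_ge0 // subr_ge0.
have uv : u - v = y - x by rewrite /u /v; ring.
have u_ge : (1 - x0) * x0 <= u.
  by apply: ler_pM => //; lra.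
have u0 : 0 <= u by lra.
have h1 : v ^+ n.+1 * V <= v * u ^+ n * U.
  apply: ler_pM => //; rewrite ?exprn_ge0 //.
    apply: prodr_ge0 => j _.
    by rewrite exprn_ge0 // mulr_ge0 ?step_num_lim_ge0 ?step_den_lim_ge0.
  by rewrite exprS ler_wpM2l // lerXn2r ?nnegrE //; lra.
have h2 : ((1 - x0) * x0) ^+ n * D x0 <= u ^+ n * U.
  apply: ler_pM => //; first by rewrite exprn_ge0 // mulr_ge0 //; lra.
  by rewrite lerXn2r ?nnegrE // mulr_ge0; lra.
have yx0 : 0 <= y - x by lra.
have := ler_wpM2l yx0 h2; rewrite -{2}uv -/u -/v exprS; lra.
Qed.

Lemma saddle_exists :
  exists x0, 0 < x0 < 1 /\ term_num_lim.[x0] = term_den_lim.[x0].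
Proof.
have e0 : term_num_lim.[0] = 1 /\ term_den_lim.[0] = 0.
  rewrite /term_num_lim /term_den_lim !horner_prod; split.
    apply: big1 => -[[|j] i] _; rewrite /step_num_lim !hornE /= ?subr0 ?expr1n //.
    by rewrite mulr0 addr0 !expr1n.
  rewrite big_ord_recl /step_den_lim !hornE mul0r expr0n gtn_eqF //.
  by rewrite mul0r.
have e1 : term_num_lim.[1] = 0 /\ 0 < term_den_lim.[1].
  rewrite /term_num_lim /term_den_lim !horner_prod; split.
    rewrite big_ord_recl /step_num_lim !hornE subrr expr0n gtn_eqF //.
    by rewrite mul0r.
  by apply: prodr_gt0 => j _; rewrite horner_exp exprn_gt0 ?step_den_lim_gt0.
have [| |x /andP[x0 x1] /rootP] := @poly_ivt R (term_den_lim - term_num_lim) 0 1.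
- exact: ler01.
- by rewrite !hornE e0.1 e0.2 e1.1; apply/andP; split; have := e1.2; lra.
rewrite !hornE => /eqP; rewrite subr_eq0 => /eqP E.
exists x; split => //; rewrite !lt_neqAle x0 x1 !andbT.
apply/andP; split; apply/eqP => xE; move: E.
  by rewrite -xE e0.1 e0.2 => /eqP; rewrite eq_sym oner_eq0.
by rewrite xE e1.1 => E; have := e1.2; rewrite E ltxx.
Qed.

(** Numerator and denominator of the function tau with
    t (N-1) k = tau (k / N) * t N k. *)
Definition drop_num : {poly R} :=
  \prod_(j < m.+1) (1 + (j%:R - 1) *: 'X) ^+ tnth r j.
Definition drop_den : {poly R} :=
  \prod_(j < m.+1) (1 + j%:R *: 'X) ^+ tnth r j.

Lemma drop_den_ge1 x : 0 <= x <= 1 -> 1 <= drop_den.[x].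
Proof.
case/andP=> x0 _; rewrite horner_prod.
elim/big_ind: _ => // [a b a1 b1|j _].
  by rewrite -[leLHS]mulr1 ler_pM.
by rewrite !hornE exprn_ege1 // lerDl mulr_ge0.
Qed.

Lemma bin_drop N k j : (0 < N)%N -> (k <= N)%N ->
  'C(N + j * k, k)%:R * (1 + (j%:R - 1) * scaled N k) =
  'C(N.-1 + j * k, k)%:R * (1 + j%:R * scaled N k) :> R.
Proof.
case: N => // N _ kN.
have Nn0 : N.+1%:R != 0 :> R by rewrite pnatr_eq0.
have := congr1 (fun n => n%:R : R) (mul_bin_down (N.+1 + j * k) k).
have kl : (k <= N.+1 + j * k)%N by apply: leq_trans kN (leq_addr _ _).
rewrite !natrM natrB // addSn /= -addSn natrD natrM => E.
rewrite /scaled /=; move: N.+1%:R Nn0 E => n n0 E.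
have -> : 1 + (j%:R - 1) * (k%:R / n) = (n + j%:R * k%:R - k%:R) / n by field.
by rewrite mulrA [_ * (_ - _)]mulrC -E; field.
Qed.

Lemma mean_drop N : (0 < N)%N ->
  mean summand N (fun k => drop_num.[scaled N k] / drop_den.[scaled N k]) =
  (franel_apery r N.-1)%:R / (franel_apery r N)%:R.
Proof.
move=> N0; rewrite /mean /mass -franel_aperyE; congr (_ / _).
rewrite franel_aperyE prednK //.
have -> : \sum_(k < N) summand N.-1 k = \sum_(k < N.+1) summand N.-1 k.
  by rewrite big_ord_recr /= summand_gtn ?addr0 // prednK.
apply: eq_bigr => -[k /= kN] _; rewrite ltnS in kN.
have d0 : drop_den.[scaled N k] != 0.
  by rewrite gt_eqF // (lt_le_trans ltr01) ?drop_den_ge1 ?scaled_itv.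
rewrite mulrA; apply: (canLR (mulfK d0)).
rewrite /summand !horner_prod -!big_split /=; apply: eq_bigr => j _.
by rewrite !hornE -!exprMn bin_drop.
Qed.

Lemma prev_ratio_expansion : exists x0 e : R,
  [/\ 0 < x0 < 1, term_num_lim.[x0] = term_den_lim.[x0] &
  isO 2 (fun N _ => (franel_apery r N.-1)%:R / (franel_apery r N)%:R
     - drop_num.[x0] / drop_den.[x0] - e / N%:R)].
Proof.
have [x0 [x0I saddle]] := saddle_exists.
have [w w0 cross] := term_lim_cross x0I.
have [P1 EP] := term_num_expands; have [Q1 EQ] := term_den_expands.
pose c := term_num_lim.[x0].
have c0 : 0 < c.
  rewrite /c saddle horner_prod; case/andP: x0I => ? _.
  by apply: prodr_gt0 => j _; rewrite horner_exp exprn_gt0 ?step_den_lim_gt0.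
have drift x : 0 <= x <= 1 ->
  w / c * (x - x0) ^+ 2 <= (x0 - x) * (term_num_lim - term_den_lim).[x].
  move=> /andP[x_ge0 x_le1]; rewrite mulrAC ler_pdivrMr // !hornE.
  case/andP: x0I => x0_gt0 x0_lt1.
  have [xx0|/ltW x0x] := leP x x0.
    have := cross x x0 x_ge0 xx0 (lexx _) (ltW x0_lt1).
    rewrite -saddle -/c => h.
    have := ler_wpM2l (_ : 0 <= x0 - x) h; rewrite subr_ge0 => /(_ xx0); lra.
  have := cross x0 x (ltW x0_gt0) (lexx _) x0x x_le1.
  rewrite -saddle -/c => h.
  have := ler_wpM2l (_ : 0 <= x - x0) h; rewrite subr_ge0 => /(_ x0x); lra.
have mass0 N : 0 < mass summand N.
  by rewrite /mass -franel_aperyE franel_apery_gt0.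
have root0 : (term_num_lim - term_den_lim).[x0] = 0.
  by rewrite !hornE saddle subrr.
have [e E] := mean_rat_expansion summand_ge0 mass0 summand_stein EP EQ
  (divr_gt0 w0 c0) x0I drift root0 drop_num drop_den_ge1.
exists x0, e; split => //; apply: isO_eq E => N k N0 _.
by rewrite mean_drop.
Qed.

End FranelApery.

(** * Binomial probabilities are O(1 / sqrt M) *)
Section BinomialPmf.
Variable R : rcfType.
Implicit Types (p s : R) (g : nat -> R).

Definition pmf (M : nat) p (k : nat) : R :=
  'C(M, k)%:R * (p ^+ k * (1 - p) ^+ (M - k)).

Lemma pmf_ge0 M p k : 0 <= p <= 1 -> 0 <= pmf M p k.
Proof. by case/andP=> p0 p1; rewrite !mulr_ge0 ?exprn_ge0 ?subr_ge0. Qed.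

Lemma sum_pmf M p : \sum_(k < M.+1) pmf M p k = 1.
Proof.
transitivity ((1 - p + p) ^+ M); last by rewrite subrK expr1n.
rewrite exprDn; apply: eq_bigr => k _.
by rewrite /pmf mulr_natl [p ^+ _ * _]mulrC.
Qed.

Lemma pmf_le1 M p k : 0 <= p <= 1 -> pmf M p k <= 1.
Proof.
move=> pI; have [kM|Mk] := leqP k M; last by rewrite /pmf bin_small // mul0r.
rewrite -(sum_pmf M p) (bigD1 (Ordinal (kM : (k < M.+1)%N))) //= lerDl.
by apply: sumr_ge0 => i _; apply: pmf_ge0.
Qed.

Lemma pmf_step M p k : (k <= M)%N ->
  pmf M p k * ((M%:R - k%:R) * p) = pmf M p k.+1 * (k.+1%:R * (1 - p)).
Proof.
rewrite leq_eqVlt => /predU1P[->|kM].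
  by rewrite subrr mul0r mulr0 /pmf bin_small // !mul0r.
have := congr1 (fun n => n%:R : R) (mul_bin_left M k).
rewrite !natrM natrB ?(ltnW kM) // => E; rewrite /pmf.
transitivity ((M%:R - k%:R) * 'C(M, k)%:R * (p ^+ k.+1 * (1 - p) ^+ (M - k))).
  by rewrite exprS; ring.
by rewrite -E -(subnSK kM) !exprS; ring.
Qed.

(** Detailed balance [pmf_step] makes the partial sums telescope; K = M + 1
    gives the Stein identity of the binomial law. *)
Lemma pmf_stein M p g K : (K <= M.+1)%N ->
  \sum_(k < K) pmf M p k * (g k.+1 * ((M%:R - k%:R) * p) - g k * (k%:R * (1 - p)))
  = g K * (pmf M p K * (K%:R * (1 - p))).
Proof.
move=> KM; pose G k := g k * (pmf M p k * (k%:R * (1 - p))).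
transitivity (\sum_(0 <= k < K) (G k.+1 - G k)); last first.
  by rewrite telescope_sumr // /G mul0r !mulr0 subr0.
rewrite big_mkord; apply: eq_bigr => k _.
rewrite /G -pmf_step; first by ring.
by rewrite -ltnS (leq_trans (ltn_ord k)).
Qed.

(** The Stein identity for g k = k - M p. *)
Lemma pmf_variance M p : 0 <= p <= 1 ->
  \sum_(k < M.+1) pmf M p k * (k%:R - M%:R * p) ^+ 2 <= M%:R.
Proof.
move=> pI; have := @pmf_stein M p (fun k => k%:R - M%:R * p) M.+1 (leqnn _).
have -> : pmf M p M.+1 = 0 by rewrite /pmf bin_small // mul0r.
rewrite mul0r mulr0 => st.
have -> : \sum_(k < M.+1) pmf M p k * (k%:R - M%:R * p) ^+ 2 =
    \sum_(k < M.+1) pmf M p k * ((M%:R - k%:R) * p).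
  apply/eqP; rewrite eq_sym -subr_eq0 -sumrB; apply/eqP; rewrite -[RHS]st.
  by apply: eq_bigr => k _; rewrite -natr1; ring.
rewrite [leRHS](_ : M%:R = \sum_(k < M.+1) pmf M p k * M%:R); last first.
  by rewrite -mulr_suml sum_pmf mul1r.
apply: ler_sum => k _.
apply: ler_wpM2l; first exact: pmf_ge0.
case/andP: pI => p0 p1; rewrite -[leRHS]mulr1; apply: ler_pM => //.
  by rewrite subr_ge0 ler_nat -ltnS.
by rewrite lerBlDr lerDl.
Qed.

(** By [pmf_stein] with g = 1, the left-hand side is the sum of M p - k over
    k < K against the law, hence at most its mean absolute deviation, which the
    variance controls. *)
Lemma pmf_flux M p K : (0 < M)%N -> 0 <= p <= 1 -> (K <= M.+1)%N ->
  K%:R * (1 - p) * pmf M p K <= 2 * Num.sqrt M%:R.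
Proof.
move=> M0 pI KM; set s := Num.sqrt _.
have s0 : 0 < s by rewrite sqrtr_gt0 ltr0n.
have s2 : s * s = M%:R by rewrite -expr2 sqr_sqrtr.
have := @pmf_stein M p (fun _ => 1) K KM; rewrite mul1r mulrC => <-.
have b k : pmf M p k *
   (1 * ((M%:R - k%:R) * p) - 1 * (k%:R * (1 - p))) <=
   pmf M p k * s + pmf M p k * (k%:R - M%:R * p) ^+ 2 / s.
  rewrite -[X in _ <= _ + X]mulrA -[leRHS]mulrDr.
  apply: ler_wpM2l; first exact: pmf_ge0.
  have -> : 1 * ((M%:R - k%:R) * p) - 1 * (k%:R * (1 - p)) =
    - (k%:R - M%:R * p) by ring.
  move: (_ - M%:R * p) => y; rewrite -(ler_pM2r s0) mulrDl divfK ?gt_eqF //.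
  have := sqr_ge0 (s / 2 + y); have := sqr_ge0 s; lra.
pose F k := pmf M p k * s + pmf M p k * (k%:R - M%:R * p) ^+ 2 / s.
have F0 k : 0 <= F k.
  apply: addr_ge0; first by rewrite mulr_ge0 ?pmf_ge0 ?(ltW s0).
  by apply: divr_ge0; rewrite ?(ltW s0) // mulr_ge0 ?sqr_ge0 ?pmf_ge0.
apply: (@le_trans _ _ (\sum_(k < K) F k)).
  by apply: ler_sum => k _; apply: b.
apply: (@le_trans _ _ (\sum_(k < M.+1) F k)).
  rewrite -[leLHS](big_mkord xpredT F) -[leRHS](big_mkord xpredT F).
  by rewrite [leRHS](big_cat_nat _ KM) //= lerDl sumr_ge0.
have -> : 2 * s = s + s by ring.
rewrite /F big_split /= -!mulr_suml sum_pmf mul1r lerD2l.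
by rewrite ler_pdivrMr // s2 pmf_variance.
Qed.

(** Adding the flux bounds at k and k + 1 gives the factor
    k (1 - p) + (M - k) p, which is at least M p (1 - p) for every k, in the
    bulk and in the tails alike. *)
Lemma pmf_bound M p k : (0 < M)%N -> 0 < p < 1 -> (k <= M)%N ->
  pmf M p k <= 4 / (p * (1 - p)) / Num.sqrt M%:R.
Proof.
move=> M0 /andP[p0 p1] kM; have pI : 0 <= p <= 1 by rewrite !ltW.
have := pmf_flux M0 pI (leqW kM).
have := @pmf_flux M p k.+1 M0 pI kM.
have := pmf_step p kM.
have b0 := pmf_ge0 M k pI.
set b := pmf M p k in b0 *; set b' := pmf M p k.+1; set s := Num.sqrt _.
have s0 : 0 < s by rewrite sqrtr_gt0 ltr0n.
have s2 : s * s = M%:R by rewrite -expr2 sqr_sqrtr.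
move=> st f1 f2.
have pq : 0 < p * (1 - p) by rewrite mulr_gt0 // subr_gt0.
rewrite ler_pdivlMr // ler_pdivlMr // -(ler_pM2r s0).
have k0 : 0 <= k%:R :> R by [].
have kM' : 0 <= M%:R - k%:R :> R by rewrite subr_ge0 ler_nat.
have h : b * ((M%:R - k%:R) * p) + k%:R * (1 - p) * b <= 4 * s by lra.
apply: le_trans h.
have -> : b * s * (p * (1 - p)) * s = b * (p * (1 - p)) * M%:R.
  by rewrite -s2; ring.
have e1 : 0 <= b * (M%:R - k%:R) * (p * p).
  by do 2![apply: mulr_ge0 => //]; apply: ltW.
have e2 : 0 <= b * k%:R * ((1 - p) * (1 - p)).
  by do 2![apply: mulr_ge0 => //]; rewrite subr_ge0 ltW.
rewrite -subr_ge0; apply: le_trans (addr_ge0 e1 e2) _.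
by rewrite le_eqVlt; apply/orP; left; apply/eqP; ring.
Qed.

End BinomialPmf.

(** * The normalised sums tend to 0 *)
Section Normalised.
Variables (R : realType) (m : nat) (r : m.+1.-tuple nat).
Hypothesis r0_gt0 : (0 < tnth r ord0)%N.
Hypothesis r_gt1 : (1 < \sum_(j < m.+1) tnth r j)%N.
Variable x0 : R.
Hypothesis x0_itv : 0 < x0 < 1.
Hypothesis saddle : (term_num_lim R r).[x0] = (term_den_lim R r).[x0].

Let nu := (drop_num R r).[x0] / (drop_den R r).[x0].
Let p (j : nat) : R := x0 / (1 + j%:R * x0).

Let den_gt0 (j : nat) : 0 < 1 + j%:R * x0.
Proof. by case/andP: x0_itv => x0_gt0 _; rewrite ltr_pwDl // mulr_ge0 // ltW. Qed.

Let p_compl j : 1 - p j = (1 + (j%:R - 1) * x0) / (1 + j%:R * x0).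
Proof. by have := den_gt0 j => d; rewrite /p; field; rewrite gt_eqF. Qed.

Lemma tilt_itv j : 0 < p j < 1.
Proof.
case/andP: x0_itv => x0_gt0 x0_lt1.
rewrite divr_gt0 //= ltr_pdivrMr // mul1r.
have : 0 <= j%:R * x0 by rewrite mulr_ge0 // ltW.
lra.
Qed.

(** The tilt p_j is chosen so that p_j (1 - p_j) ^ (j - 1) is the reciprocal of
    the limiting ratio of step j at x0; the dependence on k then cancels in the
    product over j by the saddle equation. *)
Lemma tilt_step (j N k : nat) : (k <= N)%N ->
  p j ^+ k * (1 - p j) ^+ (N + j * k - k) * (step_num_lim R j).[x0] ^+ k =
  (1 - p j) ^+ N * (step_den_lim R j).[x0] ^+ k.
Proof.
case: j => [|i] kN.
  rewrite mul0n addn0 /step_num_lim /step_den_lim /= !hornE mulr1 /p.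
  rewrite mul0r addr0 divr1.
  by rewrite -mulrA -exprD subnK // mulrC.
have -> : (N + i.+1 * k - k = N + i * k)%N by rewrite mulSn addnCA addKn.
rewrite /step_num_lim /step_den_lim /= !hornE [(1 - _) ^+ (_ + _)]exprD -!exprM.
rewrite [X in _ = _ * X]exprMn -exprM mulrCA -!mulrA; congr (_ * _).
rewrite p_compl /p !expr_div_n mulSn [X in _ ^+ (k + X)]mulnC.
rewrite -natr1 addrK exprD; set d := 1 + (_ + 1) * x0.
have d0 : d != 0 by rewrite /d natr1 gt_eqF.
rewrite mulnC; field.
by rewrite !expf_neq0.
Qed.

Lemma normalised_sum N : (franel_apery r N)%:R * nu ^+ N =
  \sum_(k < N.+1) \prod_(j < m.+1) pmf (N + j * k) (p j) k ^+ tnth r j.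
Proof.
have nuE : nu = \prod_(j < m.+1) (1 - p j) ^+ tnth r j.
  rewrite /nu /drop_num /drop_den !horner_prod -prodf_div.
  by apply: eq_bigr => j _; rewrite !hornE -expr_div_n p_compl.
have u0 : 0 < (term_num_lim R r).[x0].
  rewrite saddle horner_prod; case/andP: x0_itv => ? _.
  by apply: prodr_gt0 => j _; rewrite horner_exp exprn_gt0 ?step_den_lim_gt0.
rewrite franel_aperyE mulr_suml; apply: eq_bigr => -[k /= kN] _.
rewrite ltnS in kN.
have uk : (term_num_lim R r).[x0] ^+ k != 0 by rewrite expf_neq0 ?gt_eqF.
apply: (mulIf uk); rewrite {1}saddle nuE /summand /term_num_lim /term_den_lim.
rewrite !horner_prod -!prodrXl -!big_split /=; apply: eq_bigr => j _.
rewrite !horner_exp -!exprM ![(tnth r j * _)%N]mulnC !exprM -!exprMn.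
by rewrite -mulrA -tilt_step // mulrA.
Qed.

(** Either r_0 > 1, and the second factor is again the one of index 0, or
    another exponent is positive. *)
Lemma prod_le_two : exists j : 'I_m.+1, forall a : 'I_m.+1 -> R,
  (forall i, 0 <= a i <= 1) ->
  \prod_(i < m.+1) a i ^+ tnth r i <= a ord0 * a j.
Proof.
have pw (a : R) n : 0 <= a <= 1 -> (0 < n)%N -> a ^+ n <= a.
  by case/andP=> a0 a1 n0; rewrite ler_iXnr.
have [r01|] := ltnP 1 (tnth r ord0).
  exists ord0 => a aI; rewrite (bigD1 ord0) //= -[leRHS]mulr1.
  apply: ler_pM.
  - by rewrite exprn_ge0 //; case/andP: (aI ord0).
  - by apply: prodr_ge0 => i _; rewrite exprn_ge0 //; case/andP: (aI i).
  - have /andP[a0 a1] := aI ord0.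
    by rewrite -expr2 ler_wiXn2l.
  - apply: prodr_ile1 => i _; have /andP[a0 a1] := aI i.
    by rewrite exprn_ge0 // exprn_ile1.
move=> r01; have r0E : tnth r ord0 = 1%N by apply/eqP; rewrite eqn_leq r01.
have [j j0 rj] : exists2 j, j != ord0 & (0 < tnth r j)%N.
  apply/exists_inP; apply: contraLR r_gt1.
  rewrite negb_exists_in => /forall_inP h.
  rewrite (bigD1 ord0) //= r0E big1 // => i i0.
  by apply/eqP; move: (h i i0); rewrite lt0n negbK.
exists j => a aI; rewrite (bigD1 ord0) //= r0E expr1.
have /andP[a00 a01] := aI ord0; apply: ler_wpM2l => //.
rewrite (bigD1 j) //= -[leRHS]mulr1; apply: ler_pM.
- by rewrite exprn_ge0 //; case/andP: (aI j).
- by apply: prodr_ge0 => i _; rewrite exprn_ge0 //; case/andP: (aI i).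
- exact: pw.
- apply: prodr_ile1 => i _; have /andP[? ?] := aI i.
  by rewrite exprn_ge0 // exprn_ile1.
Qed.

Lemma normalised_small (eps : R) : 0 < eps -> exists n0 : nat, forall N,
  (n0 <= N)%N -> (franel_apery r N)%:R * nu ^+ N < eps.
Proof.
move=> eps0; have [j le2] := prod_le_two.
pose C := 4 / (p j * (1 - p j)).
have C0 : 0 < C.
  have /andP[pj0 pj1] := tilt_itv j.
  by rewrite divr_gt0 // mulr_gt0 // subr_gt0.
exists (Num.bound ((C / eps) ^+ 2)).+1 => N nN.
have N0 : (0 < N)%N by apply: leq_trans nN.
have s0 : 0 < Num.sqrt N%:R :> R by rewrite sqrtr_gt0 ltr0n.
apply: (@le_lt_trans _ _ (C / Num.sqrt N%:R)).
  rewrite normalised_sum -[leRHS]mul1r.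
  rewrite -[X in _ <= X * _](sum_pmf N (p 0)) mulr_suml.
  apply: ler_sum => -[k /= kN] _; rewrite ltnS in kN.
  have aI (i : 'I_m.+1) : 0 <= pmf (N + i * k) (p i) k <= 1.
    have /andP[pi0 pi1] := tilt_itv i.
    by rewrite pmf_ge0 ?pmf_le1 // !ltW.
  apply: le_trans (le2 _ aI) _; rewrite mul0n addn0.
  have /andP[b0 _] := aI ord0; rewrite mul0n addn0 in b0.
  apply: ler_wpM2l => //.
  have kM : (k <= N + j * k)%N by apply: leq_trans kN (leq_addr _ _).
  have M0 : (0 < N + j * k)%N by rewrite addn_gt0 N0.
  apply: le_trans (pmf_bound M0 (tilt_itv j) kM) _.
  rewrite -/C ler_pM2l // lef_pV2 ?posrE // ?sqrtr_gt0 ?ltr0n //.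
  by apply: ler_wsqrtr; rewrite ler_nat leq_addr.
rewrite ltr_pdivrMr // mulrC -ltr_pdivrMr //.
have q0 : 0 <= C / eps by rewrite ltW // divr_gt0.
rewrite -(ger0_norm q0) -sqrtr_sqr ltr_sqrt ?ltr0n //.
apply: lt_le_trans (archi_boundP (sqr_ge0 _)) _.
by rewrite ler_nat ltnW.
Qed.

End Normalised.

(** * From the expansion of the ratio to the sign of the second difference *)
Section LogConcavity.
Variable R : realType.

Lemma root_ratio_ltE (u : nat -> nat) (n : nat) : (forall k, 0 < u k)%N ->
  (root_ratio R u n.+1 < root_ratio R u n) =
  (ln (u n.+2)%:R / n.+2%:R + ln (u n)%:R / n%:R
     < 2 * (ln (u n.+1)%:R / n.+1%:R) :> R).
Proof.
move=> u0; have uE k : nth_root_seq R u k = expR (ln (u k)%:R / k%:R).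
  by rewrite /nth_root_seq /powR pnatr_eq0 gtn_eqF // mulrC.
rewrite /root_ratio !uE -!expRB ltr_expR.
move: (ln (u n.+2)%:R / _) (ln (u n.+1)%:R / _) (ln (u n)%:R / _) => a b c.
by apply/idP/idP; lra.
Qed.

Lemma le_ln_sub1 (x : R) : 0 < x -> ln x <= x - 1.
Proof. by move=> x0; rewrite -{1}(subrKC 1 x) le_ln1Dx //; lra. Qed.

Lemma near_one_bounds (w c C N : R) : 1 <= N ->
  `|w - 1 - c / N| <= C / N ^+ 2 ->
  N * (w - 1) <= `|c| + C /\ N - (`|c| + C) <= N * w.
Proof.
move=> N1 h; have N0 : 0 < N by lra.
have : `|N * (w - 1) - c| <= C.
  have -> : N * (w - 1) - c = N * (w - 1 - c / N) by field; rewrite gt_eqF.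
  rewrite normrM gtr0_norm //; apply: le_trans (ler_wpM2l (ltW N0) h) _.
  have C0 : 0 <= C.
    have := le_trans (normr_ge0 _) h.
    by rewrite pmulr_lge0 // invr_gt0 exprn_gt0.
  have -> : N * (C / N ^+ 2) = C / N by field; rewrite gt_eqF.
  by rewrite ler_pdivrMr // ler_peMr.
rewrite ler_norml => /andP[h1 h2].
have := ler_norm c; have := ler_norm (- c); rewrite normrN => c1 c2.
by split; lra.
Qed.

(** The inequality ln x <= x - 1 bounds from above n ln w and n ln w', where w
    and w' are consecutive ratios, and n ^ 2 (ln w - ln w') through
    (w - w') / w'. *)
Lemma ln_ratio_diff2 (Z : nat -> R) (c C : R) :
  (forall n, 0 < Z n) ->
  (forall n, (0 < n)%N -> `|Z n.-1 / Z n - 1 - c / n%:R| <= C / n%:R ^+ 2) ->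
  (forall eps, 0 < eps -> exists n0, forall n, (n0 <= n)%N -> Z n < eps) ->
  exists n0, forall n, (n0 <= n)%N ->
  ln (Z n.+2) / n.+2%:R + ln (Z n) / n%:R < 2 * (ln (Z n.+1) / n.+1%:R).
Proof.
move=> Z0 ratio small.
have C0 : 0 <= C.
  have := le_trans (normr_ge0 _) (ratio 1%N isT).
  by rewrite pmulr_lge0 // invr_gt0 exprn_gt0.
pose B := `|c| + C.
have B0 : 0 <= B by rewrite addr_ge0.
have [n0 Zn0] := small _ (expR_gt0 (- (2 * `|c| + 3 * C))).
(* The second bound forces every later ratio w' to be at least 1 / 2. *)
exists (maxn n0 (Num.bound (2 * B)).+1) => n; rewrite geq_max => /andP[nn0 nB].
have n_gt0 : (0 < n)%N by apply: leq_trans nB.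
pose N : R := n.+1%:R.
have N2 : 2 <= N by rewrite /N ler_nat.
have NB : 2 * B <= N.
  have B2 : 0 <= 2 * B by rewrite mulr_ge0.
  apply: ltW; apply: lt_le_trans (archi_boundP B2) _.
  by rewrite ler_nat; apply: leq_trans (leqW (ltnW nB)) _.
have nE : n%:R = N - 1 by rewrite /N -natr1 addrK.
have SE : n.+2%:R = N + 1 by rewrite /N -natr1.
pose w := Z n / Z n.+1; pose w' := Z n.+1 / Z n.+2.
have w_gt0 : 0 < w by rewrite divr_gt0.
have w'_gt0 : 0 < w' by rewrite divr_gt0.
have wB : `|w - 1 - c / N| <= C / N ^+ 2 by exact: (ratio n.+1 isT).
have wB' : `|w' - 1 - c / (N + 1)| <= C / (N + 1) ^+ 2.
  by rewrite -SE; exact: (ratio n.+2 isT).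
have zE : ln (Z n) = ln (Z n.+1) + ln w.
  by rewrite -lnM ?posrE // /w mulrC divfK // gt_eqF.
have zE' : ln (Z n.+2) = ln (Z n.+1) - ln w'.
  rewrite -ln_div ?posrE // /w' invf_div mulrC divfK // gt_eqF //.
have z_small : ln (Z n.+1) < - (2 * `|c| + 3 * C).
  rewrite -(expRK (- _)) ltr_ln ?posrE ?expR_gt0 //.
  by apply: Zn0; apply: leqW.
have N0 : 0 < N by lra.
have N1 : 1 <= N by lra.
have N1' : 1 <= N + 1 by lra.
have [hw _] := near_one_bounds N1 wB.
have [hw' w'_ge] := near_one_bounds N1' wB'.
rewrite -/B in hw hw' w'_ge.
have w'_half : 1 / 2 <= w'.
  rewrite -(ler_pM2l (lt_le_trans ltr01 N1')); lra.
pose K := `|c| + 2 * C.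
have K0 : 0 <= K by rewrite addr_ge0 // mulr_ge0.
have diff : N ^+ 2 * (w - w') <= K.
  move: wB wB'; rewrite !ler_norml => /andP[_ wu] /andP[wl' _].
  have N2_gt0 : 0 < N ^+ 2 by rewrite exprn_gt0.
  have -> : K = N ^+ 2 * (K / N ^+ 2) by rewrite mulrC divfK // gt_eqF.
  apply: ler_wpM2l; first exact: ltW.
  have q : C / (N + 1) ^+ 2 <= C / N ^+ 2.
    apply: ler_wpM2l => //; rewrite lef_pV2 ?posrE ?exprn_gt0 //; last by lra.
    by rewrite lerXn2r ?nnegrE; lra.
  have cc : c / N - c / (N + 1) <= `|c| / N ^+ 2.
    have -> : c / N - c / (N + 1) = c / (N * (N + 1)).
      by field; rewrite !gt_eqF //; lra.
    apply: (@le_trans _ _ (`|c| / (N * (N + 1)))).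
      by rewrite ler_pM2r ?ler_norm // invr_gt0 mulr_gt0 //; lra.
    apply: ler_wpM2l => //; rewrite lef_pV2 ?posrE ?mulr_gt0 //; last by lra.
    by rewrite expr2 ler_pM2l //; lra.
  rewrite /K.
  have -> : (`|c| + 2 * C) / N ^+ 2 =
    `|c| / N ^+ 2 + C / N ^+ 2 + C / N ^+ 2.
    by ring.
  move: (C / N ^+ 2) (C / (N + 1) ^+ 2) (c / N) (c / (N + 1))
    (`|c| / N ^+ 2) wu wl' q cc.
  by move=> ? ? ? ? ?; lra.
have l1 : N ^+ 2 * (ln w - ln w') <= 2 * K.
  have ww : ln w - ln w' <= (w - w') / w'.
    rewrite -ln_div ?posrE //.
    apply: le_trans (le_ln_sub1 (divr_gt0 w_gt0 w'_gt0)) _.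
    by rewrite mulrBl divff // gt_eqF.
  apply: le_trans (ler_wpM2l (sqr_ge0 N) ww) _.
  rewrite mulrA ler_pdivrMr //; apply: le_trans diff _.
  have := ler_wpM2l K0 w'_half; lra.
have l2 : N * ln w <= B.
  by apply: le_trans hw; rewrite ler_pM2l // le_ln_sub1.
have l3 : N * ln w' <= B.
  have [p|/ltW q] := leP 0 (ln w'); last first.
    by apply: le_trans B0; apply: mulr_ge0_le0 => //; apply: ltW.
  apply: le_trans hw'; apply: ler_pM => //; by rewrite ?le_ln_sub1 //; lra.
rewrite SE nE -/N zE zE'; move: (ln w) (ln w') (ln (Z n.+1)) l1 l2 l3 z_small.
move=> l l' a l1 l2 l3 a_small.
rewrite -subr_gt0.
have -> : 2 * (a / N) - ((a - l') / (N + 1) + (a + l) / (N - 1)) =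
  - (N ^+ 2 * (l - l') + N * l + N * l' + 2 * a) / (N * (N + 1) * (N - 1)).
  by field; rewrite !gt_eqF //; lra.
apply: divr_gt0; first by move: l1 l2 l3; rewrite /B /K; lra.
by rewrite !mulr_gt0 //; lra.
Qed.
End LogConcavity.

Unset Implicit Arguments.

Theorem theorem2 (R : realType) (m : nat) (r : m.+1.-tuple nat)
    (hr0 : (0 < tnth r ord0)%N)
    (hr : (1 < \sum_(j < m.+1) tnth r j)%N) :
  exists nr : nat, forall n : nat, (nr <= n)%N ->
    root_ratio R (franel_apery r) n.+1 < root_ratio R (franel_apery r) n.
Proof.
have [x0 [e [x0I saddle [C ratio]]]] := prev_ratio_expansion R hr0.
set nu := _ / _ in ratio.
have small := normalised_small hr0 hr x0I saddle; rewrite -/nu in small.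
have S0 n : 0 < (franel_apery r n)%:R :> R by apply: franel_apery_gt0.
have nu0 : 0 < nu.
  case/andP: x0I => x0_gt0 x0_lt1.
  have xI : 0 <= x0 <= 1 by rewrite !ltW.
  rewrite divr_gt0 //; last exact: lt_le_trans (drop_den_ge1 r xI).
  rewrite horner_prod; apply: prodr_gt0 => j _; rewrite !hornE exprn_gt0 //.
  have : 0 <= j%:R * x0 by rewrite mulr_ge0 // ltW.
  lra.
pose Z n : R := (franel_apery r n)%:R * nu ^+ n.
have Z0 n : 0 < Z n by rewrite mulr_gt0 // exprn_gt0.
have Zratio n : (0 < n)%N ->
    `|Z n.-1 / Z n - 1 - e / nu / n%:R| <= C / nu / n%:R ^+ 2.
  move=> n0; have := ratio n 0%N n0 (leq0n n).
  have -> : Z n.-1 / Z n - 1 - e / nu / n%:R =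
    ((franel_apery r n.-1)%:R / (franel_apery r n)%:R - nu - e / n%:R) / nu.
    case: n n0 => // n _; have: n.+1%:R != 0 :> R by rewrite pnatr_eq0.
    rewrite /Z /= exprS; move: n.+1%:R => d d0; field.
    by rewrite d0 !gt_eqF ?exprn_gt0.
  rewrite normrM normfV (gtr0_norm nu0) => h.
  by rewrite ler_pdivrMr // mulrAC divfK // gt_eqF.
have [n0 lnZ] := ln_ratio_diff2 Z0 Zratio small.
exists n0.+1 => n nn0.
rewrite root_ratio_ltE; last by move=> k; rewrite -(ltr0n R).
have lnS k : ln (Z k) = ln (franel_apery r k)%:R + k%:R * ln nu.
  by rewrite /Z lnM ?posrE ?exprn_gt0 // lnXn // mulr_natl.
have := lnZ n (ltnW nn0); rewrite !lnS.
have n_neq0 : n != 0%N by rewrite -lt0n (leq_trans _ nn0).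
have split k (a : R) : k%:R != 0 :> R ->
    (a + k%:R * ln nu) / k%:R = a / k%:R + ln nu.
  by move=> k0; field.
rewrite !split ?pnatr_eq0 //.
move: (ln (franel_apery r n.+2)%:R / _) (ln (franel_apery r n.+1)%:R / _).
move: (ln (franel_apery r n)%:R / _) => a b c; lra.
Qed.
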